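(* For every integer $n\geq 2$, the signature of braids $\sigma:B_\infty\to\mathbb{R}$ is a $\nu_n$-quasimorphism; that is, there exists a constant $C>0$ such that for all $\alpha,\beta\in B_\infty$, $$|\sigma(\alpha\beta)-\sigma(\alpha)-\sigma(\beta)|\leq C\min\{\nu_n(\alpha),\nu_n(\beta)\}.$$
   Context: $B_n$ denotes the braid group on $n$ strands with standard Artin generators $\sigma_1,\dots,\sigma_{n-1}$. Via the standard inclusions $B_n\to B_{n+1}$, $\sigma_i\mapsto\sigma_i$ (adding a trivial string), put $B_\infty=\bigcup_{n\ge 1}B_n$. For $\alpha\in B_n$, $\widehat{\alpha}$ denotes the closure of $\alpha$ (an oriented link in $S^3$), and $\sigma(\alpha)$ is defined to be the signature $\sigma(\widehat{\alpha})$ of this link. Since adding a trivial string does not change the signature of the closure, this gives a well-defined function $\sigma:B_\infty\to\mathbb{R}$. For $n\ge2$, $\nu_n$ is the conjugation-invariant norm on $B_\infty$ defined by letting $\nu_n(f)$ be the minimal $l\ge0$ such that $f=(g_1k_1g_1^{-1})\cdots(g_lk_lg_l^{-1})$ for some $k_i\in B_n$, $g_i\in B_\infty$ (the identity being the empty product). *)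

(* Defs.v *)
From HB Require Import structures.
From mathcomp Require Import all_boot all_order all_algebra.
From mathcomp Require Import boolp reals.

Set Implicit Arguments.
Unset Strict Implicit.
Unset Printing Implicit Defensive.

Import Order.TTheory GRing.Theory Num.Theory.

Local Open Scope quotient_scope.

(* The group B_oo is presented by generators s_0, s_1, ... (s_i is the Artin
   generator sigma_(i+1), exchanging strands i and i+1, with strands numbered
   from 0) and the braid relations.  A derivation involves finitely many
   generators, so this is the union of the B_n along the inclusions
   s_i |-> s_i. *)

(* (i, true) stands for s_i and (i, false) for its inverse. *)
Definition letter : Type := nat * bool.
Definition word : Type := seq letter.

Inductive braid_eq : word -> word -> Prop :=
| braid_refl w : braid_eq w w
| braid_sym u v : braid_eq u v -> braid_eq v u
| braid_trans u v w : braid_eq u v -> braid_eq v w -> braid_eq u w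
| braid_cat u u' v v' :
    braid_eq u u' -> braid_eq v v' -> braid_eq (u ++ v) (u' ++ v')
| braid_cancel i b : braid_eq [:: (i, b); (i, ~~ b)] [::]
| braid_far i j : i.+1 < j ->
    braid_eq [:: (i, true); (j, true)] [:: (j, true); (i, true)]
| braid_near i :
    braid_eq [:: (i, true); (i.+1, true); (i, true)]
             [:: (i.+1, true); (i, true); (i.+1, true)].

Definition braid_rel : rel word := fun u v => `[< braid_eq u v >].

Lemma braid_rel_refl : reflexive braid_rel.
Proof. by move=> u; apply/asboolP; exact: braid_refl. Qed.

Lemma braid_rel_sym : symmetric braid_rel.
Proof. by move=> u v; apply/asboolP/asboolP; exact: braid_sym. Qed.

Lemma braid_rel_trans : transitive braid_rel.
Proof.
move=> v u w /asboolP uv /asboolP vw; apply/asboolP; exact: braid_trans vw.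
Qed.

Canonical braid_equiv :=
  EquivRel braid_rel braid_rel_refl braid_rel_sym braid_rel_trans.

Definition Binf : Type := {eq_quot braid_equiv}.

HB.instance Definition _ := Choice.on Binf.
HB.instance Definition _ : EqQuotient _ braid_equiv Binf := EqQuotient.on Binf.

Definition braid (w : word) : Binf := \pi_Binf w.

Lemma braidP u v : braid u = braid v <-> braid_eq u v.
Proof.
split; first by move/eqquotP => /= /asboolP.
by move=> h; apply/eqquotP => /=; apply/asboolP.
Qed.

Lemma reprbK (a : Binf) : braid (repr a) = a.
Proof. exact: reprK. Qed.

Definition inv_word (w : word) : word := rev [seq (x.1, ~~ x.2) | x <- w].

Lemma inv_word_cat u v : inv_word (u ++ v) = inv_word v ++ inv_word u.
Proof. by rewrite /inv_word map_cat rev_cat. Qed.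

Lemma inv_wordK : involutive inv_word.
Proof.
move=> w; rewrite /inv_word map_rev revK -map_comp -[RHS]map_id.
by apply: eq_map => -[i b] /=; rewrite negbK.
Qed.

Lemma cat_inv_word w : braid_eq (w ++ inv_word w) [::].
Proof.
elim: w => [|[i b] w ih]; first exact: braid_refl.
rewrite -cat1s inv_word_cat -catA catA.
apply: braid_trans (braid_cancel i b).
rewrite -[X in braid_eq _ X]/([:: (i, b)] ++ ([::] ++ [:: (i, ~~ b)])) -!catA.
apply: braid_cat; first exact: braid_refl.
by rewrite catA; apply: braid_cat => //; exact: braid_refl.
Qed.

Lemma inv_cat_word w : braid_eq (inv_word w ++ w) [::].
Proof. by have := cat_inv_word (inv_word w); rewrite inv_wordK. Qed.

Lemma inv_word_eq u v : braid_eq u v -> braid_eq (inv_word u) (inv_word v).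
Proof.
move=> uv; apply: (@braid_trans _ (inv_word u ++ (v ++ inv_word v))).
  rewrite -[X in braid_eq X _]cats0; apply: braid_cat; first exact: braid_refl.
  by apply: braid_sym; exact: cat_inv_word.
rewrite catA -[X in braid_eq _ X]cat0s; apply: braid_cat; last exact: braid_refl.
apply: braid_trans (inv_cat_word u).
by apply: braid_cat; [exact: braid_refl | exact: braid_sym].
Qed.

Definition Bone : Binf := braid [::].
Definition Bmul (a b : Binf) : Binf := braid (repr a ++ repr b).
Definition Binv (a : Binf) : Binf := braid (inv_word (repr a)).

Lemma BmulE u v : Bmul (braid u) (braid v) = braid (u ++ v).
Proof. by apply/braidP; apply: braid_cat; apply/braidP; rewrite reprbK. Qed.

Lemma BinvE u : Binv (braid u) = braid (inv_word u).
Proof. by apply/braidP; apply: inv_word_eq; apply/braidP; rewrite reprbK. Qed.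

Lemma BmulA : associative Bmul.
Proof.
by move=> a b c; rewrite -(reprbK a) -(reprbK b) -(reprbK c) !BmulE catA.
Qed.

Lemma Bmul1 : left_id Bone Bmul.
Proof. by move=> a; rewrite -(reprbK a) BmulE. Qed.

Lemma B1mul : right_id Bone Bmul.
Proof. by move=> a; rewrite -(reprbK a) BmulE cats0. Qed.

Lemma BmulV : left_inverse Bone Binv Bmul.
Proof.
move=> a; rewrite -(reprbK a) BinvE BmulE; apply/braidP; exact: inv_cat_word.
Qed.

Lemma BVmul : right_inverse Bone Binv Bmul.
Proof.
move=> a; rewrite -(reprbK a) BinvE BmulE; apply/braidP; exact: cat_inv_word.
Qed.

HB.instance Definition _ := isGroup.Build Binf BmulA Bmul1 B1mul BmulV BVmul.

Lemma braidM u v : (braid u * braid v)%g = braid (u ++ v).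
Proof. exact: BmulE. Qed.

Lemma braidV u : ((braid u)^-1)%g = braid (inv_word u).
Proof. exact: BinvE. Qed.

(* The word only involves generators of B_n. *)
Definition word_in (n : nat) (w : word) : bool := all (fun x => x.1.+1 < n) w.

Definition in_B (n : nat) (a : Binf) : Prop :=
  exists2 w, word_in n w & a = braid w.

Definition conj_product (n l : nat) (f : Binf) : Prop :=
  exists s : seq (Binf * Binf),
    [/\ size s = l, forall x, x \in s -> in_B n x.2
      & f = (\prod_(x <- s) (x.1 * x.2 * x.1^-1))%g].

Lemma conj_product_gen i b : exists g,
  braid [:: (i, b)] = (g * braid [:: (0, b)] * g^-1)%g.
Proof.
elim: i => [|i [g ih]]; first by exists 1%g; rewrite mul1g invg1 mulg1.
pose h := braid [:: (i, true); (i.+1, true)].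
have hT : (h * braid [:: (i, true)] = braid [:: (i.+1, true)] * h)%g.
  by rewrite !braidM; apply/braidP; exact: braid_near.
have bF j : braid [:: (j, false)] = ((braid [:: (j, true)])^-1)%g.
  by rewrite braidV.
have hb : braid [:: (i.+1, b)] = (h * braid [:: (i, b)] * h^-1)%g.
  have e : braid [:: (i.+1, true)] = (h * braid [:: (i, true)] * h^-1)%g.
    by rewrite hT mulgK.
  by case: b {ih} => //; rewrite !bF e !invgM invgK mulgA.
by exists (h * g)%g; rewrite hb ih invgM !mulgA.
Qed.

Lemma conj_product_ex n (hn : 1 < n) (f : Binf) :
  exists l, `[< conj_product n l f >].
Proof.
rewrite -(reprbK f); elim: (repr f) => [|[i b] w [l /asboolP[s [sl sB sE]]]].
  by exists 0; apply/asboolP; exists [::]; split; rewrite ?big_nil.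
have [g gE] := conj_product_gen i b.
exists l.+1; apply/asboolP; exists ((g, braid [:: (0, b)]) :: s); split => /=.
- by rewrite sl.
- move=> x; rewrite inE => /orP[/eqP -> /=|/sB //].
  by exists [:: (0, b)]; rewrite //= /word_in /= hn.
- by rewrite big_cons /= -gE -sE braidM.
Qed.

Definition nu (n : nat) (hn : 1 < n) (f : Binf) : nat :=
  ex_minn (conj_product_ex hn f).

(* An oriented link diagram, recorded through its oriented (Seifert)
   smoothing, which replaces each crossing c by two parallel arcs: (c, false)
   on the left and (c, true) on the right, as seen in the direction of the
   strands.  Each Seifert circle is the list, in the order of its orientation
   and from an arbitrary base point, of the arcs it runs through; [::] is a
   crossingless circle.  [positive c] tells the sign of c.  Planarity of the
   diagram is not recorded: it holds for the closed braids built below. *)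
Record diagram := Diagram {
  ncross : nat;
  positive : 'I_ncross -> bool;
  circles : seq (seq ('I_ncross * bool));
  circlesP : forall a, count_mem a (flatten circles) = 1
}.

(* Closure of w as a braid on n strands oriented upwards; the smoothing
   consists of the n closed strands.  Letter p = (i, b) is a crossing of sign b
   between strands i and i+1, so it lies to the right of strand i and to the
   left of strand i+1. *)
Section Closure.
Variables (n : nat) (w : word).

Definition cindex (p : 'I_(size w)) : nat := (tnth (in_tuple w) p).1.

Definition csign (p : 'I_(size w)) : bool := (tnth (in_tuple w) p).2.

Definition strand (j : nat) : seq ('I_(size w) * bool) :=
  [seq (p, cindex p != j)
     | p <- enum 'I_(size w) & (cindex p == j) || ((cindex p).+1 == j)].

Lemma strandP (hw : word_in n w) a :
  count_mem a (flatten [seq strand j | j <- iota 0 n]) = 1.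
Proof.
case: a => p b.
have cE j : count_mem (p, b) (strand j) = (j == cindex p + b).
  rewrite count_uniq_mem; last first.
    by rewrite map_inj_uniq ?filter_uniq -?enumT ?enum_uniq // => x y [].
  congr nat_of_bool; apply/mapP/eqP => [[q]|->].
    rewrite mem_filter => /andP[+ _] [-> ->].
    case: eqP => [-> _|_ /= /eqP <-]; by rewrite ?addn0 ?addn1.
  exists p; last by case: b; rewrite ?addn0 ?addn1 // ?eqxx ?(ltn_eqF (ltnSn _)).
  rewrite mem_filter mem_enum andbT.
  by case: b; rewrite ?addn0 ?addn1 eqxx ?orbT.
rewrite count_flatten -map_comp.
have -> : sumn [seq (count_mem (p, b) \o strand) j | j <- iota 0 n] =
          count_mem (cindex p + b) (iota 0 n).
  by rewrite -sumn_count; congr sumn; apply: eq_map => j /=; rewrite cE.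
rewrite count_uniq_mem ?iota_uniq // mem_iota /= add0n.
have : (cindex p).+1 < n by apply: (allP hw); exact: mem_tnth.
by case: b {cE} => h; rewrite ?addn1 ?addn0 ?h // (ltn_trans (ltnSn _) h).
Qed.

Definition closure (hw : word_in n w) : diagram :=
  @Diagram (size w) csign [seq strand j | j <- iota 0 n] (strandP hw).

End Closure.

Local Open Scope ring_scope.

Section Signature.
Variable R : realFieldType.

Definition pos_def_on n (S W : 'M[R]_n) : Prop :=
  forall v : 'rV[R]_n, (v <= W)%MS -> v != 0 -> 0 < (v *m S *m v^T) 0 0.

(* The largest dimension of a subspace of the row space of U on which the
   quadratic form v |-> v S v^T is positive definite. *)
Definition pos_index n (U S : 'M[R]_n) : nat :=
  \max_(r < n.+1 | `[< exists W : 'M[R]_n,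
     [/\ (W <= U)%MS, \rank W = r & pos_def_on S W] >]) r.

(* Signature of the restriction of the form to the row space of U. *)
Definition signature n (U S : 'M[R]_n) : int :=
  (pos_index U S)%:Z - (pos_index U (- S))%:Z.

(* The Seifert surface F of a diagram D consists of disjoint disks bounded by
   the Seifert circles, pushed below the projection sphere, and of one
   half-twisted band per crossing c, from the disk of its left arc to the disk
   of its right arc.  F retracts onto the Seifert graph (one vertex per disk,
   one edge per band), so H_1(F; R) is the space of cycles of this graph,
   i.e., the kernel of its boundary operator.  If D is split then F is
   disconnected; tubing its components together only adds to H_1 classes in
   the radical of the Seifert form, which do not affect the signature. *)
Definition seifert_boundary (D : diagram) :
    'M[R]_(ncross D, size (circles D)) :=
  \matrix_(c, j) let C := nth [::] (circles D) j in
    ((c, true) \in C)%:R - ((c, false) \in C)%:R.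

Definition seifert_cycles (D : diagram) : 'M[R]_(ncross D) :=
  kermx (seifert_boundary D).

(* Let x and y be cycles, y^+ and y^- the two push-offs of y off F.  The
   symmetrized Seifert form V + V^T takes at (x, y) the value
   lk(x, y^+) + lk(y, x^+) = lk(x, y^+) + lk(x, y^-), which is the sum of:
   - for each crossing c, of sign e, the term - e x_c y_c, due to the half
     twist of the band;
   - for each Seifert circle C, bounding the disk E, the intersection numbers
     on E of the part of x coming from the right side of C with the part of y
     coming from its left side, and of the same parts of y and x: the two sides
     lie on opposite sides of E, so exactly one push-off of y links.  Parts
     coming from the same side of C do not contribute.
   On E, oriented so that its boundary is C, a cycle x is a sum of chords from
   a centre to the arcs (c, false) of C (c lies to the right of C), with weight
   x_c, and of chords from the arcs (d, true) of C (d lies to the left of C) to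
   the centre, with weight x_d.  The weights of a cycle add up to 0 on each
   side of C, so the first intersection number is the sum over these c and d of
   x_c y_d / 2 times +1 or -1, according as (d, true) comes before or after
   (c, false) along C; it does not depend on the base point of C. *)
Definition seifert_disk (D : diagram) : 'M[R]_(ncross D) :=
  \matrix_(c, d) \sum_(C <- circles D | ((c, false) \in C) && ((d, true) \in C))
    2%:R^-1 * (if (index (d, true) C < index (c, false) C)%N then 1 else -1).

Definition seifert_form (D : diagram) : 'M[R]_(ncross D) :=
  diag_mx (\row_c (if positive c then -1 else 1))
  + seifert_disk D + (seifert_disk D)^T.

(* With this sign convention the right-handed trefoil has signature -2. *)
Definition link_signature (D : diagram) : int :=
  signature (seifert_cycles D) (seifert_form D).

End Signature.

(* The least n such that w is a word in the generators of B_n and n > 0. *)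
Definition width (w : word) : nat := (\max_(x <- w) x.1.+2 + nilp w)%N.

Lemma word_in_width w : word_in (width w) w.
Proof.
apply/allP => x xw; rewrite /width.
apply: leq_trans (leq_addr _ _).
by rewrite (big_rem x xw) /= leq_maxl.
Qed.

(* The signature of the closure of a braid, computed on the closure of an
   arbitrary word representing the braid (repr a is a chosen one); as the
   signature is a link invariant the choice does not matter. *)
Definition sigma (R : realType) (a : Binf) : R :=
  (link_signature R (closure (word_in_width (repr a))))%:~R.

(* Main.v *)
Require Import Defs.
From mathcomp Require Import all_boot all_order all_algebra.
From mathcomp Require Import boolp reals.
From mathcomp Require Import ring lra zify.

(* Order the letters of a word [w] by position and let letter [p] have index
   [i_p] and sign [e_p].  A cycle of the Seifert graph of the closure of [w] is
   a vector [x] whose coordinates sum to 0 over the letters of each given index,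
   and on cycles the Seifert form is
     Q_w(x) = - sum_p e_p x_p^2 + sum_(p < q) 2 a(i_p, i_q) x_p x_q
   with [a] antisymmetric.  For a concatenation [u v], the sums [s(x)], [s(y)]
   of a cycle [(x, y)] by index satisfy [s(x) = - s(y)], so the interaction of
   [u] and [v] is [2 a(s(x), s(y)) = 0] and [Q_uv(x, y) = Q_u(x) + Q_v(y)] under
   the only coupling [s(x) + s(y) = 0].  This makes invariance under
   conjugation and under the braid relations a matter of small linear maps.  If
   [u] is in B_n, the coupling splits on a subspace of codimension at most [n],
   so |sigma(uv) - sigma(u) - sigma(v)| <= n; peeling off the factors of a
   product of conjugates one by one gives the theorem with C = 2 n. *)

Set Implicit Arguments.
Unset Strict Implicit.
Unset Printing Implicit Defensive.

Import Order.TTheory GRing.Theory Num.Theory.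

Local Open Scope ring_scope.

(** * Positive index of a quadratic form *)

Section Forms.
Variable R : realFieldType.

Definition bil n (S : 'M[R]_n) (u v : 'rV[R]_n) : R := (u *m S *m v^T) 0 0.
Definition qform n (S : 'M[R]_n) (v : 'rV[R]_n) : R := bil S v v.

Lemma bilDl n (S : 'M[R]_n) u u' v : bil S (u + u') v = bil S u v + bil S u' v.
Proof. by rewrite /bil !mulmxDl mxE. Qed.

Lemma bilDr n (S : 'M[R]_n) u v v' : bil S u (v + v') = bil S u v + bil S u v'.
Proof. by rewrite /bil linearD /= mulmxDr mxE. Qed.

Lemma bilZl n (S : 'M[R]_n) a u v : bil S (a *: u) v = a * bil S u v.
Proof. by rewrite /bil -!scalemxAl mxE. Qed.

Lemma bilZr n (S : 'M[R]_n) a u v : bil S u (a *: v) = a * bil S u v.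
Proof. by rewrite /bil linearZ /= -scalemxAr mxE. Qed.

Lemma bilC n (S : 'M[R]_n) u v : S^T = S -> bil S u v = bil S v u.
Proof.
move=> sS; rewrite /bil -[in RHS]sS.
by rewrite -[v in RHS]trmxK -!trmx_mul mulmxA [RHS]mxE.
Qed.

Lemma qformD n (S : 'M[R]_n) u v : S^T = S ->
  qform S (u + v) = qform S u + qform S v + 2 * bil S u v.
Proof.
by move=> sS; rewrite /qform !bilDl !bilDr (bilC v u sS); ring.
Qed.

Lemma qformZ n (S : 'M[R]_n) a v : qform S (a *: v) = a ^+ 2 * qform S v.
Proof. by rewrite /qform bilZl bilZr mulrA. Qed.

Lemma qform0 n (S : 'M[R]_n) : qform S 0 = 0.
Proof. by rewrite /qform /bil !mul0mx mxE. Qed.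

Lemma qformN n (S : 'M[R]_n) v : qform (- S) v = - qform S v.
Proof. by rewrite /qform /bil mulmxN mulNmx mxE. Qed.

Lemma trmxN_sym n (S : 'M[R]_n) : S^T = S -> (- S)^T = - S.
Proof. by move=> sS; rewrite linearN /= sS. Qed.

Lemma pos_index_ge n (U S : 'M[R]_n) r (B : 'M[R]_(r, n)) :
  (B <= U)%MS -> (forall u : 'rV_r, u != 0 -> 0 < qform S (u *m B)) ->
  (r <= pos_index U S)%N.
Proof.
move=> BU pB.
have fB : \rank B = r.
  apply/eqP; apply: inj_row_free => u uB; apply/eqP/negPn/negP => /pB.
  by rewrite uB qform0 ltxx.
have rn : (r < n.+1)%N by rewrite ltnS -fB rank_leq_col.
rewrite /pos_index.
apply: (@leq_bigmax_cond _ _ (fun r : 'I_n.+1 => r : nat) (Ordinal rn)).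
apply/asboolP; exists <<B>>%MS; split; rewrite ?genmxE //.
move=> v; rewrite genmxE => /submxP[u ->] uB0; apply: pB.
by apply: contraNneq uB0 => ->; rewrite mul0mx.
Qed.

Lemma pos_index_basis n (U S : 'M[R]_n) :
  exists2 B : 'M[R]_(pos_index U S, n), (B <= U)%MS &
    forall u : 'rV_(pos_index U S), u != 0 -> 0 < qform S (u *m B).
Proof.
have [] := @eq_bigmax_cond _ (fun r : 'I_n.+1 => `[< exists W : 'M[R]_n,
     [/\ (W <= U)%MS, \rank W = r & pos_def_on S W] >])
   (fun r : 'I_n.+1 => r : nat).
  apply/card_gt0P; exists ord0; apply/asboolP; exists 0.
  split; rewrite ?sub0mx ?mxrank0 // => v; rewrite submx0 => /eqP ->.
  by rewrite eqxx.
move=> r /asboolP[W [WU rW pW]] er.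
have {}er : pos_index U S = \rank W by rewrite rW -er.
rewrite er; exists (row_base W); first by rewrite eq_row_base.
move=> u u0; apply: pW.
  by rewrite (submx_trans (submxMl _ _)) ?eq_row_base.
apply: contraNneq u0 => uW.
by apply/eqP/(row_free_inj (row_base_free W)); rewrite uW mul0mx.
Qed.

(** [F] records the products with a maximal positive definite subspace of [U]. A vector of [U]
    orthogonal to that subspace and with positive value could be added to it. *)
Lemma pos_index_ker n (U S : 'M[R]_n) : S^T = S ->
  exists F : 'M[R]_(n, pos_index U S), forall v : 'rV_n,
    (v <= U)%MS -> v *m F = 0 -> qform S v <= 0.
Proof.
move=> sS; have [B BU pB] := pos_index_basis U S.
exists (S *m B^T) => v vU vF; rewrite leNgt; apply/negP => v0.
suff : (pos_index U S + 1 <= pos_index U S)%N by rewrite addn1 ltnn.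
apply: (@pos_index_ge _ _ _ _ (col_mx B v)); first by rewrite col_mx_sub BU.
move=> u; rewrite -[u]hsubmxK; set u1 := lsubmx u; set u2 := rsubmx u.
rewrite mul_row_col [u2]mx11_scalar mul_scalar_mx; set c := u2 0 0 => h.
have -> : qform S (u1 *m B + c *: v) = qform S (u1 *m B) + c ^+ 2 * qform S v.
  rewrite qformD // qformZ bilZr bilC // /bil trmx_mul.
  by rewrite mulmxA -[v *m S *m _]mulmxA vF mul0mx mxE !mulr0 addr0.
have [c0|c0] := eqVneq c 0.
  rewrite c0 expr0n mul0r addr0; apply: pB; apply: contraNneq h => ->.
  by rewrite c0 raddf0 row_mx0.
have c2 : 0 < c ^+ 2 * qform S v by rewrite mulr_gt0 // exprn_even_gt0.
have [->|/pB/ltW u1p] := eqVneq u1 0; first by rewrite mul0mx qform0 add0r.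
by rewrite ltr_wpDl.
Qed.

(** A positive definite subspace of [U] meets the kernel of [F] only in 0, so [F] is injective on
    it. *)
Lemma pos_index_le_codim n (U S : 'M[R]_n) k (F : 'M[R]_(n, k)) :
  (forall v : 'rV_n, (v <= U)%MS -> v *m F = 0 -> qform S v <= 0) ->
  (pos_index U S <= k)%N.
Proof.
move=> hF; have [B BU pB] := pos_index_basis U S.
have /eqP <- : row_free (B *m F); last exact: rank_leq_col.
apply: inj_row_free => u uBF; apply/eqP/negPn/negP => /pB.
rewrite ltNge hF ?(submx_trans (submxMl _ _)) //.
by rewrite -mulmxA.
Qed.

Lemma pos_index_dim0 (U S : 'M[R]_0) : pos_index U S = 0%N.
Proof.
apply/eqP; rewrite -leqn0; apply: (@pos_index_le_codim _ _ _ _ 0) => v _ _.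
by rewrite [v]thinmx0 qform0.
Qed.

(** By [pos_index_ker], [pos_index U1 S1 + pos_index U2 S2] linear conditions, together with the [k]
    conditions in [G], make the form nonpositive on [U]. *)
Lemma pos_index_subadd n n1 n2 k (U S : 'M[R]_n) (U1 S1 : 'M[R]_n1)
    (U2 S2 : 'M[R]_n2) (f1 : 'M[R]_(n, n1)) (f2 : 'M[R]_(n, n2))
    (G : 'M[R]_(n, k)) :
  S1^T = S1 -> S2^T = S2 ->
  (forall v : 'rV_n, (v <= U)%MS -> v *m G = 0 ->
    [/\ (v *m f1 <= U1)%MS, (v *m f2 <= U2)%MS
      & qform S v <= qform S1 (v *m f1) + qform S2 (v *m f2)]) ->
  (pos_index U S <= pos_index U1 S1 + pos_index U2 S2 + k)%N.
Proof.
move=> sS1 sS2 h.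
have [F1 hF1] := pos_index_ker U1 sS1; have [F2 hF2] := pos_index_ker U2 sS2.
apply: (@pos_index_le_codim _ _ _ _ (row_mx (row_mx (f1 *m F1) (f2 *m F2)) G)).
move=> v vU; rewrite !mul_mx_row -[0]row_mx0 => /eq_row_mx[].
rewrite -[0]row_mx0 => /eq_row_mx[]; rewrite !mulmxA => v1 v2 v3.
have [w1 w2 w3] := h v vU v3.
by apply: le_trans w3 _; rewrite -[0]addr0 lerD ?hF1 ?hF2.
Qed.

(** The form is positive on the sum of the images of two maximal positive definite subspaces;
    positivity also makes these images independent. *)
Lemma pos_index_superadd n n1 n2 (U S : 'M[R]_n) (U1 S1 : 'M[R]_n1)
    (U2 S2 : 'M[R]_n2) (g1 : 'M[R]_(n1, n)) (g2 : 'M[R]_(n2, n)) :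
  (forall (v1 : 'rV_n1) (v2 : 'rV_n2), (v1 <= U1)%MS -> (v2 <= U2)%MS ->
    ((v1 *m g1 + v2 *m g2)%R <= U)%MS /\
    qform S1 v1 + qform S2 v2 <= qform S (v1 *m g1 + v2 *m g2)) ->
  (pos_index U1 S1 + pos_index U2 S2 <= pos_index U S)%N.
Proof.
move=> h; have [B1 B1U p1] := pos_index_basis U1 S1.
have [B2 B2U p2] := pos_index_basis U2 S2.
have sub1 (u : 'rV_(pos_index U1 S1)) : (u *m B1 <= U1)%MS.
  by rewrite (submx_trans (submxMl _ _)).
have sub2 (u : 'rV_(pos_index U2 S2)) : (u *m B2 <= U2)%MS.
  by rewrite (submx_trans (submxMl _ _)).
have E (u : 'rV_(pos_index U1 S1 + pos_index U2 S2)) :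
    u *m col_mx (B1 *m g1) (B2 *m g2) =
    lsubmx u *m B1 *m g1 + rsubmx u *m B2 *m g2.
  by rewrite -{1}[u]hsubmxK mul_row_col !mulmxA.
apply: (@pos_index_ge _ _ _ _ (col_mx (B1 *m g1) (B2 *m g2))).
  apply/rV_subP => v /submxP[u ->]; rewrite E.
  by have [hU _] := h _ _ (sub1 (lsubmx u)) (sub2 (rsubmx u)); exact: hU.

move=> u u0; rewrite E.
have [_] := h _ _ (sub1 (lsubmx u)) (sub2 (rsubmx u)).
apply: lt_le_trans.
have [l0|/p1 l0] := eqVneq (lsubmx u) 0.
  rewrite l0 mul0mx qform0 add0r; apply: p2; apply: contraNneq u0 => r0.
  by rewrite -[u]hsubmxK l0 r0 row_mx0.
apply: ltr_wpDr => //.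
have [->|/p2/ltW//] := eqVneq (rsubmx u) 0; by rewrite mul0mx qform0.
Qed.

(** This is [pos_index_subadd] with a second form of dimension 0 and no extra condition. The map [f]
    may have a kernel in [U]: the form vanishes there. *)
Lemma pos_index_map n n' (U S : 'M[R]_n) (U' S' : 'M[R]_n')
    (f : 'M[R]_(n, n')) :
  S'^T = S' ->
  (forall v : 'rV_n, (v <= U)%MS ->
    (v *m f <= U')%MS /\ qform S v = qform S' (v *m f)) ->
  (pos_index U S <= pos_index U' S')%N.
Proof.
move=> sS' h.
have := @pos_index_subadd n n' 0 0 U S U' S' 0 0 f 0 0 sS' (trmx0 _ _ _).
rewrite pos_index_dim0 !addn0; apply => v vU _.
have [h1 h2] := h v vU; split => //.
  by rewrite mulmx0 sub0mx.
by rewrite mulmx0 qform0 addr0 h2.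
Qed.

Lemma signature_iso n n' (U S : 'M[R]_n) (U' S' : 'M[R]_n')
    (f : 'M[R]_(n, n')) (g : 'M[R]_(n', n)) :
  S^T = S -> S'^T = S' ->
  (forall v : 'rV_n, (v <= U)%MS ->
    (v *m f <= U')%MS /\ qform S v = qform S' (v *m f)) ->
  (forall v : 'rV_n', (v <= U')%MS ->
    (v *m g <= U)%MS /\ qform S' v = qform S (v *m g)) ->
  signature U S = signature U' S'.
Proof.
move=> sS sS' hf hg; rewrite /signature; congr (_%:Z - _%:Z);
  apply/eqP; rewrite eqn_leq.
  by rewrite (pos_index_map sS' hf) (pos_index_map sS hg).
apply/andP; split.
  apply: (pos_index_map (trmxN_sym sS') (f := f)) => v /hf[-> e].
  by rewrite !qformN e.
apply: (pos_index_map (trmxN_sym sS) (f := g)) => v /hg[-> e].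
by rewrite !qformN e.
Qed.

(** The hyperbolic plane spanned by [z] and [y] accounts for the 1. For one inequality, the
    complement of [z] is cut out by a single linear condition; for the other, a positive line is
    added to a shifted copy of it. *)
Lemma pos_index_isotropic n (U S : 'M[R]_n) (z y : 'rV[R]_n) :
  S^T = S -> (z <= U)%MS -> (y <= U)%MS -> qform S z = 0 -> bil S y z != 0 ->
  pos_index U S = (pos_index (U :&: kermx (S *m z^T))%MS S + 1)%N.
Proof.
move=> sS zU yU z0 yz; set U0 := (U :&: _)%MS; apply/eqP; rewrite eqn_leq.
apply/andP; split.
  have := @pos_index_subadd n n 0 1 U S U0 S 0 0 1%:M 0 (S *m z^T) sS
            (trmx0 _ _ _).
  rewrite pos_index_dim0 addn0; apply => v vU vz.
  rewrite !mulmx1 mulmx0 sub0mx; split => //.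
    by rewrite sub_capmx vU; apply/sub_kermxP.
  by rewrite qform0 addr0.
pose b := bil S y z.
(* [y'] has [qform S y' = 1], and [g] shifts [U0] along [z] to make it
   orthogonal to [y']. *)
pose y' := y + ((1 - qform S y) / (2 * b)) *: z.
pose g := 1%:M - S *m y^T *m (b^-1 *: z).
rewrite addnC.
apply: (@leq_trans (pos_index (1%:M : 'M[R]_1) 1%:M + pos_index U0 S)).
  rewrite leq_add2r; apply: (@pos_index_ge _ _ _ _ 1%:M); first exact: submx1.
  move=> u; rewrite mulmx1 [u]mx11_scalar /qform /bil mulmx1 tr_scalar_mx.
  rewrite -scalar_mxM mxE eqxx mulr1n -expr2 exprn_even_gt0 //= => h.
  by apply: contraNneq h => ->; rewrite raddf0.
apply: (@pos_index_superadd _ _ _ _ _ _ _ _ _ y' g) => c v _.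
rewrite sub_capmx => /andP[vU /sub_kermxP vz].
have -> : v *m g = v + (- (bil S v y / b)) *: z.
  rewrite mulmxBr mulmx1 mulmxA [v *m (S *m _)]mulmxA [v *m S *m _]mx11_scalar.
  by rewrite mul_scalar_mx scalerA scaleNr.
rewrite [c]mx11_scalar mul_scalar_mx; set d := c 0 0.
have bvz : bil S v z = 0 by rewrite /bil -mulmxA vz mxE.
split.
  by rewrite !addmx_sub ?scalemx_sub ?addmx_sub ?scalemx_sub.
rewrite /y' scalerDr !qformD // !(bilDl, bilDr, qformZ, bilZl, bilZr, qformD) //.
rewrite z0 bvz ?(bilC z v) // ?bvz ?(bilC z y) // ?(bilC y v) // -/b.
rewrite -[bil S z z]/(qform S z) z0.
have -> : qform 1%:M d%:M = d ^+ 2.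
  by rewrite /qform /bil mulmx1 tr_scalar_mx -scalar_mxM mxE eqxx mulr1n.
rewrite le_eqVlt; apply/orP; left; apply/eqP.
by field; rewrite yz.
Qed.

(** If [z] is orthogonal to [U], the intersection is all of [U]. Otherwise the positive indices of
    [S] and of [- S] both drop by 1, which leaves their difference unchanged. *)
Lemma signature_isotropic n (U S : 'M[R]_n) (z : 'rV[R]_n) :
  S^T = S -> (z <= U)%MS -> qform S z = 0 ->
  signature U S = signature (U :&: kermx (S *m z^T))%MS S.
Proof.
move=> sS zU z0; have [h|/matrix0Pn[i [j h]]] := eqVneq (U *m (S *m z^T)) 0.
  apply: (@signature_iso _ _ _ _ _ _ 1%:M 1%:M) => // v;
    rewrite mulmx1 sub_capmx; last by case/andP.
  move=> vU; split => //; rewrite vU; apply/sub_kermxP.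
  by case/submxP: vU => u ->; rewrite -mulmxA h mulmx0.
have h' : bil S (row i U) z != 0.
  by rewrite /bil -mulmxA -row_mul mxE -[0 : 'I_1](ord1 j).
rewrite /signature (pos_index_isotropic _ zU (row_sub i U) z0 h') //.
rewrite (pos_index_isotropic (S := - S) _ zU (row_sub i U)) ?trmxN_sym //.
- rewrite mulNmx; set V1 := (U :&: _)%MS; set V2 := (U :&: kermx (- _))%MS.
  have -> : pos_index V2 (- S) = pos_index V1 (- S).
    apply/eqP; rewrite eqn_leq; apply/andP; split;
      apply: (@pos_index_map _ _ _ _ _ _ 1%:M);
      rewrite ?trmxN_sym // => v; rewrite mulmx1 !sub_capmx;
      move=> /andP[-> /sub_kermxP h1];
      split => //; apply/sub_kermxP.
    + by move/eqP: h1; rewrite mulmxN oppr_eq0 => /eqP.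
    + by rewrite mulmxN h1 oppr0.
  by rewrite !PoszD; ring.
- by rewrite qformN z0 oppr0.
- by rewrite /bil mulmxN mulNmx mxE oppr_eq0.
Qed.

End Forms.

(** * Concatenation *)

Section Join.
Variables (R : realFieldType) (N : nat) (A : 'M[R]_N).
Hypothesis antiA : A^T = - A.

Definition join_cols m1 m2 (C1 : 'M[R]_(m1, N)) (C2 : 'M[R]_(m2, N)) :=
  col_mx C1 C2.

(** For words, [x *m C1] is the vector of sums of [x] by index, and the two blocks interact only
    through these sums. *)
Definition join_form m1 m2 (C1 : 'M[R]_(m1, N)) (C2 : 'M[R]_(m2, N))
    (S1 : 'M[R]_m1) (S2 : 'M[R]_m2) : 'M[R]_(m1 + m2) :=
  block_mx S1 (C1 *m A *m C2^T) (C1 *m A *m C2^T)^T S2.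

Lemma join_form_sym m1 m2 (C1 : 'M[R]_(m1, N)) (C2 : 'M[R]_(m2, N)) S1 S2 :
  S1^T = S1 -> S2^T = S2 ->
  (join_form C1 C2 S1 S2)^T = join_form C1 C2 S1 S2.
Proof. by move=> s1 s2; rewrite /join_form tr_block_mx trmxK s1 s2. Qed.

Lemma bil_anti (u : 'rV[R]_N) : bil A u u = 0.
Proof.
have /matrixP/(_ 0 0) : (u *m A *m u^T)^T = - (u *m A *m u^T).
  by rewrite !trmx_mul trmxK antiA mulNmx mulmxN mulmxA.
rewrite [LHS]mxE [RHS]mxE -/(bil A u u) => h.
lra.
Qed.

Lemma qform_block m1 m2 (x : 'rV[R]_m1) (y : 'rV[R]_m2) S1 T S2 :
  qform (block_mx S1 T T^T S2) (row_mx x y) =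
  qform S1 x + qform S2 y + 2 * (x *m T *m y^T) 0 0.
Proof.
have e : (y *m T^T *m x^T) 0 0 = (x *m T *m y^T) 0 0.
  by rewrite -[y in LHS]trmxK -!trmx_mul mulmxA [LHS]mxE.
rewrite /qform /bil mul_row_block tr_row_mx mul_row_col !mulmxDl.
have addE (a b : 'M[R]_1) : (a + b) 0 0 = a 0 0 + b 0 0 by rewrite mxE.
by rewrite !addE e; ring.
Qed.

(* The interaction [x C1 A C2^T y^T] equals [- (x C1) A (x C1)^T = 0]. *)
Lemma qform_join m1 m2 (C1 : 'M[R]_(m1, N)) (C2 : 'M[R]_(m2, N)) S1 S2 x y :
  x *m C1 + y *m C2 = 0 ->
  qform (join_form C1 C2 S1 S2) (row_mx x y) = qform S1 x + qform S2 y.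
Proof.
move=> /eqP; rewrite addrC addr_eq0 => /eqP xy; rewrite /join_form qform_block.
rewrite !mulmxA -mulmxA -trmx_mul xy linearN /= mulmxN mxE -/(bil _ _ _).
by rewrite bil_anti oppr0 mulr0 addr0.
Qed.

Lemma join_cycles m1 m2 (C1 : 'M[R]_(m1, N)) (C2 : 'M[R]_(m2, N))
    (x : 'rV_m1) (y : 'rV_m2) :
  (row_mx x y <= kermx (join_cols C1 C2))%MS = (x *m C1 + y *m C2 == 0).
Proof. by apply/sub_kermxP/eqP; rewrite mul_row_col. Qed.

(** Exchanging the blocks changes the sign of the interaction, but the interaction vanishes on
    cycles. This gives invariance under conjugation. *)
Lemma signature_joinC m1 m2 (C1 : 'M[R]_(m1, N)) (C2 : 'M[R]_(m2, N)) S1 S2 :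
  S1^T = S1 -> S2^T = S2 ->
  signature (kermx (join_cols C1 C2)) (join_form C1 C2 S1 S2) =
  signature (kermx (join_cols C2 C1)) (join_form C2 C1 S2 S1).
Proof.
move=> s1 s2; apply: (@signature_iso _ _ _ _ _ _ _ (block_mx 0 1%:M 1%:M 0)
  (block_mx 0 1%:M 1%:M 0)); rewrite ?join_form_sym // => v;
  rewrite -[v]hsubmxK join_cycles mul_row_block !mulmx0 !mulmx1 add0r addr0
    join_cycles addrC => /eqP h; rewrite h eqxx;
  by split => //; rewrite !qform_join // 1?addrC.
Qed.

(** This serves to replace a subword: [M] and [M'] preserve the sums by index and the form, so they
    extend by the identity on the rest of the word. *)
Lemma signature_join_iso m1 m2 m3 (C1 : 'M[R]_(m1, N)) (C2 : 'M[R]_(m2, N))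
    (C3 : 'M[R]_(m3, N)) S1 S2 S3 (M : 'M_(m1, m2)) (M' : 'M_(m2, m1)) :
  S1^T = S1 -> S2^T = S2 -> S3^T = S3 ->
  M *m C2 = C1 -> M' *m C1 = C2 ->
  (forall x, qform S1 x = qform S2 (x *m M)) ->
  (forall x, qform S2 x = qform S1 (x *m M')) ->
  signature (kermx (join_cols C1 C3)) (join_form C1 C3 S1 S3) =
  signature (kermx (join_cols C2 C3)) (join_form C2 C3 S2 S3).
Proof.
move=> s1 s2 s3 e e' q q'.
apply: (@signature_iso _ _ _ _ _ _ _ (block_mx M 0 0 1%:M)
  (block_mx M' 0 0 1%:M)); rewrite ?join_form_sym // => v;
  rewrite -[v]hsubmxK join_cycles mul_row_block !mulmx0 !mulmx1 add0r addr0
    join_cycles -mulmxA ?e ?e' => /eqP h; rewrite h eqxx; split => //;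
  by rewrite !qform_join // -?q -?q' // -mulmxA ?e ?e'.
Qed.

(* The vector [z] is the annulus class carried by two cancelling crossings;
   its orthogonal complement modulo [z] is the space of cycles of the rest. *)
Lemma signature_join_cancel m1 m2 (C1 : 'M[R]_(m1, N)) (C2 : 'M[R]_(m2, N))
    S1 S2 (z : 'rV_m1) :
  S1^T = S1 -> S2^T = S2 ->
  z *m C1 = 0 -> qform S1 z = 0 ->
  (forall x, bil S1 x z = 0 -> x *m C1 = 0 /\ qform S1 x = 0) ->
  signature (kermx (join_cols C1 C2)) (join_form C1 C2 S1 S2) =
  signature (kermx C2) S2.
Proof.
move=> s1 s2 zC qz h.
have sJ := join_form_sym C1 C2 s1 s2.
have zK : (row_mx z 0 <= kermx (join_cols C1 C2))%MS.
  by rewrite join_cycles mul0mx addr0 zC.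
have Jz x y : bil (join_form C1 C2 S1 S2) (row_mx x y) (row_mx z 0) =
    bil S1 x z.
  rewrite (bilC _ _ sJ) (bilC _ _ s1) /bil mul_row_block !mul0mx !addr0.
  by rewrite !mulmxA zC !mul0mx tr_row_mx mul_row_col mul0mx addr0.
rewrite (signature_isotropic sJ zK); last first.
  by rewrite qform_join ?zC ?mul0mx ?addr0 // qform0 qz addr0.
apply: (@signature_iso _ _ _ _ _ _ _ (col_mx 0 1%:M) (row_mx 0 1%:M)) => // v.
  rewrite -[v]hsubmxK mul_row_col mulmx0 mulmx1 add0r sub_capmx join_cycles.
  move=> /andP[/eqP hv /sub_kermxP hz].
  have [xC xq] : lsubmx v *m C1 = 0 /\ qform S1 (lsubmx v) = 0.
    by apply: h; rewrite -(Jz _ (rsubmx v)) /bil -mulmxA hz mxE.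
  rewrite qform_join // xq add0r; split => //; apply/sub_kermxP.
  by move: hv; rewrite xC add0r.
move=> /sub_kermxP vC; rewrite mul_mx_row mulmx0 mulmx1.
have e : 0 *m C1 + v *m C2 = 0 by rewrite mul0mx add0r.
rewrite qform_join // qform0 add0r sub_capmx join_cycles e eqxx; split => //.
apply/sub_kermxP/rowP => i; rewrite [i]ord1 mulmxA -/(bil _ _ _) Jz.
by rewrite /bil !mul0mx !mxE.
Qed.

(** Pairs of cycles of the two parts give the lower bound. For the upper bound, the [k] conditions
    in [G] force each part of a cycle to be a cycle by itself. *)
Lemma pos_index_join m1 m2 k (C1 : 'M[R]_(m1, N)) (C2 : 'M[R]_(m2, N))
    S1 S2 (G : 'M[R]_(m1, k)) :
  S1^T = S1 -> S2^T = S2 -> (forall x : 'rV_m1, x *m G = 0 -> x *m C1 = 0) ->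
  let p := pos_index (kermx (join_cols C1 C2)) (join_form C1 C2 S1 S2) in
  let q := (pos_index (kermx C1) S1 + pos_index (kermx C2) S2)%N in
  (q <= p <= q + k)%N.
Proof.
move=> s1 s2 hG /=; apply/andP; split.
  apply: (@pos_index_superadd _ _ _ _ _ _ _ _ _ _
    (row_mx 1%:M 0) (row_mx 0 1%:M)).
  move=> x y /sub_kermxP xC /sub_kermxP yC.
  rewrite !mul_mx_row !mulmx1 !mulmx0 add_row_mx addr0 add0r join_cycles.
  have e : x *m C1 + y *m C2 = 0 by rewrite xC yC addr0.
  by rewrite qform_join // e eqxx lexx.
apply: (@pos_index_subadd _ _ _ _ _ _ _ _ _ _ _ (col_mx 1%:M 0) (col_mx 0 1%:M)
  (col_mx G 0)) => // v.
rewrite -[v]hsubmxK !mul_row_col !mulmx1 !mulmx0 addr0 addr0 add0r join_cycles.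
move=> /eqP e /hG xC; rewrite qform_join //; split => //; apply/sub_kermxP => //.
by move: e; rewrite xC add0r.
Qed.

End Join.

Lemma join_form_opp (R : realFieldType) N (A : 'M[R]_N) m1 m2
    (C1 : 'M[R]_(m1, N)) (C2 : 'M[R]_(m2, N)) S1 S2 :
  - join_form A C1 C2 S1 S2 = join_form (- A) C1 C2 (- S1) (- S2).
Proof. by rewrite /join_form opp_block_mx !mulmxN mulNmx linearN. Qed.

(** The defects of the positive indices of the form and of its opposite both lie between 0 and [k],
    so their difference is bounded by [k] rather than by twice [k]. *)
Lemma signature_join_bound (R : realFieldType) N (A : 'M[R]_N) m1 m2 k
    (C1 : 'M[R]_(m1, N)) (C2 : 'M[R]_(m2, N)) S1 S2 (G : 'M[R]_(m1, k)) :
  A^T = - A -> S1^T = S1 -> S2^T = S2 ->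
  (forall x : 'rV_m1, x *m G = 0 -> x *m C1 = 0) ->
  `|signature (kermx (join_cols C1 C2)) (join_form A C1 C2 S1 S2)
    - signature (kermx C1) S1 - signature (kermx C2) S2| <= k%:Z.
Proof.
move=> aA s1 s2 hG; rewrite /signature join_form_opp.
have aN : (- A)^T = - - A by rewrite linearN /= aA.
have := pos_index_join aA C2 s1 s2 hG.
have /= := pos_index_join aN C2 (trmxN_sym s1) (trmxN_sym s2) hG.
lia.
Qed.

(** * Forms of words and braid relations *)

Section Words.
Variables (R : realFieldType) (N : nat).

(** This is the coefficient a of the form: crossings of consecutive indices share exactly one closed
    strand, and 1/2 is the weight found in [seifert_disk]. *)
Definition adj (i j : nat) : R :=
  2%:R^-1 * ((j == i.+1)%:R - (i == j.+1)%:R).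
Definition adj_mx : 'M[R]_N := \matrix_(i, j) adj i j.

Lemma adj_mx_anti : adj_mx^T = - adj_mx.
Proof. by apply/matrixP => i j; rewrite !mxE /adj; ring. Qed.

(* Letters of index at least [N] do not interact, so that in this section only
   [word_signature_near] needs [N] to be large. *)
Definition adj_trunc (i j : nat) : R :=
  if (i < N)%N && (j < N)%N then adj i j else 0.

Lemma adj_truncC i j : adj_trunc j i = - adj_trunc i j.
Proof. by rewrite /adj_trunc /adj andbC; case: ifP => _; ring. Qed.

(** Letters are given by a function on [nat] and a separate length [m], so that cutting a word in
    two involves no cast between matrix sizes. *)
Definition letter_cols m (l : nat -> letter) : 'M[R]_(m, N) :=
  \matrix_(p, i) ((l p).1 == i)%:R.

Definition letter_form m (l : nat -> letter) : 'M[R]_m :=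
  \matrix_(p, q) (if p == q then if (l p).2 then -1 else 1
                  else if (p < q)%N then adj_trunc (l p).1 (l q).1
                  else adj_trunc (l q).1 (l p).1).

Lemma sum_delta (F : nat -> R) (a : nat) :
  \sum_(i < N) (a == i :> nat)%:R * F i = if (a < N)%N then F a else 0.
Proof.
case: ltnP => h.
  rewrite (bigD1 (Ordinal h)) //= eqxx mul1r big1 ?addr0 // => i.
  by rewrite -val_eqE eq_sym /= => /negPf ->; rewrite mul0r.
rewrite big1 // => i _; case: eqP => [e|_]; last by rewrite mul0r.
by have := ltn_ord i; rewrite -e ltnNge h.
Qed.

(** The matrix products sum over the indices below [N] only, which is where the truncation comes
    from. *)
Lemma letter_cols_adj m m' l l' p q :
  (letter_cols m l *m adj_mx *m (letter_cols m' l')^T) p q =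
  adj_trunc (l p).1 (l' q).1.
Proof.
rewrite mxE /adj_trunc.
transitivity (\sum_(j < N) ((l' q).1 == j)%:R *
                (if ((l p).1 < N)%N then adj (l p).1 j else 0)).
  apply: eq_bigr => j _; rewrite !mxE mulrC; congr (_ * _).
  rewrite -(sum_delta (fun i => adj i j)).
  by apply: eq_bigr => i _; rewrite !mxE.
rewrite (sum_delta (fun j => if ((l p).1 < N)%N then adj (l p).1 j else 0)).
by case: (_ < N)%N; case: (_ < N)%N.
Qed.

Lemma letter_form_sym m l : (letter_form m l)^T = letter_form m l.
Proof.
apply/matrixP => p q; rewrite !mxE eq_sym; case: eqVneq => [->//|].
by rewrite -val_eqE /=; case: ltngtP.
Qed.

Lemma letter_cols_add m1 m2 l :
  letter_cols (m1 + m2) l =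
  join_cols (letter_cols m1 l) (letter_cols m2 (fun p => l (m1 + p)%N)).
Proof.
apply/matrixP => p i; rewrite !mxE; case: splitP => q e; by rewrite !mxE e.
Qed.

Lemma letter_form_add m1 m2 l (l' := fun p => l (m1 + p)%N) :
  letter_form (m1 + m2) l =
  join_form adj_mx (letter_cols m1 l) (letter_cols m2 l')
    (letter_form m1 l) (letter_form m2 l').
Proof.
apply/matrixP => p q; rewrite -[p]splitK -[q]splitK /join_form.
case: (split p) => i; case: (split q) => j /=;
  rewrite ?block_mxEul ?block_mxEur ?block_mxEdl ?block_mxEdr.
- by rewrite !mxE /= (inj_eq (@lshift_inj _ _)).
- rewrite letter_cols_adj mxE /= -val_eqE /=.
  have ij : (i < m1 + j)%N by rewrite ltn_addr.
  by rewrite ltn_eqF // ij.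
- rewrite [in RHS]mxE letter_cols_adj mxE /= -val_eqE /=.
  have ij : (j < m1 + i)%N by rewrite ltn_addr.
  by rewrite gtn_eqF // ltnNge ltnW.
- by rewrite !mxE /= (inj_eq (@rshift_inj _ _)) ltn_add2l.
Qed.

Definition letter_signature m l : int :=
  signature (kermx (letter_cols m l)) (letter_form m l).

Lemma eq_letter_cols m l l' :
  (forall p, (p < m)%N -> l p = l' p) -> letter_cols m l = letter_cols m l'.
Proof. by move=> h; apply/matrixP => p i; rewrite !mxE h. Qed.

Lemma eq_letter_form m l l' :
  (forall p, (p < m)%N -> l p = l' p) -> letter_form m l = letter_form m l'.
Proof. by move=> h; apply/matrixP => p q; rewrite !mxE !h. Qed.

Definition nth_letter (w : word) : nat -> letter := nth (0, true) w.
Definition word_cols w := letter_cols (size w) (nth_letter w).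
Definition word_form w := letter_form (size w) (nth_letter w).
Definition word_signature w := letter_signature (size w) (nth_letter w).

Lemma word_signature_cat u v :
  word_signature (u ++ v) =
  signature (kermx (join_cols (word_cols u) (word_cols v)))
    (join_form adj_mx (word_cols u) (word_cols v) (word_form u) (word_form v)).
Proof.
rewrite /word_signature size_cat /letter_signature letter_cols_add.
rewrite letter_form_add.
have e1 p : (p < size u)%N -> nth_letter (u ++ v) p = nth_letter u p.
  by move=> h; rewrite /nth_letter nth_cat h.
have e2 p : (p < size v)%N -> nth_letter (u ++ v) (size u + p) = nth_letter v p.
  by move=> h; rewrite /nth_letter nth_cat ltnNge leq_addr /= addKn.
by rewrite (eq_letter_cols e1) (eq_letter_form e1) (eq_letter_cols e2)
  (eq_letter_form e2).
Qed.

Lemma word_signature_rot u v :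
  word_signature (u ++ v) = word_signature (v ++ u).
Proof.
by rewrite !word_signature_cat; apply: signature_joinC;
  rewrite ?adj_mx_anti ?letter_form_sym.
Qed.

Lemma bil_sum m (S : 'M[R]_m) x y :
  bil S x y = \sum_j (\sum_i x 0 i * S i j) * y 0 j.
Proof. by rewrite /bil mxE; apply: eq_bigr => j _; rewrite !mxE. Qed.

Lemma word_signature_cancel i b v :
  word_signature ([:: (i, b); (i, ~~ b)] ++ v) = word_signature v.
Proof.
rewrite word_signature_cat.
pose z : 'rV[R]_2 := \row_k (if k == 0 then 1 else -1).
have c0 : adj_trunc i i = 0.
  by rewrite /adj_trunc /adj; case: ifP => // _; rewrite !ltn_eqF // subrr mulr0.
apply: (@signature_join_cancel _ _ _ _ _ _ _ _ _ _ z);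
  rewrite ?adj_mx_anti ?letter_form_sym //.
- by apply/rowP => k; rewrite !mxE !big_ord_recl big_ord0 !mxE /=; ring.
- rewrite /qform bil_sum !big_ord_recl !big_ord0 !mxE /= c0.
  by case: b; rewrite /=; ring.
move=> x; rewrite /qform !bil_sum !big_ord_recl !big_ord0 !mxE /= c0 => h.
(* The two diagonal entries are opposite, so orthogonality to [z] makes [x] a multiple of [z]. *)
have {}h : x 0 (lift ord0 ord0) = - x 0 ord0 by case: b h => /= h; lra.
rewrite h; split; last by case: b; rewrite /=; ring.
by apply/rowP => k; rewrite !mxE !big_ord_recl big_ord0 !mxE /= h; ring.
Qed.

Lemma word_signature_far i j v : (i.+1 < j)%N ->
  word_signature ([:: (i, true); (j, true)] ++ v) =
  word_signature ([:: (j, true); (i, true)] ++ v).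
Proof.
move=> ij; rewrite !word_signature_cat.
have c0 : adj_trunc i j = 0.
  rewrite /adj_trunc /adj; case: ifP => // _.
  by rewrite gtn_eqF // ltn_eqF ?subrr ?mulr0 //; lia.
have c0' : adj_trunc j i = 0 by rewrite adj_truncC c0 oppr0.
pose M : 'M[R]_2 := \matrix_(p, q) (p != q)%:R.
apply: (@signature_join_iso _ _ _ _ _ _ _ _ _ _ _ _ _ M M);
  rewrite ?adj_mx_anti ?letter_form_sym //.
1,2: by apply/matrixP => p k; rewrite !mxE !big_ord_recl big_ord0 !mxE /=;
  case: p => [[|[|[|p]]] hp] //=; ring.
all: by move=> x; rewrite /qform !bil_sum !big_ord_recl !big_ord0 !mxE
  !big_ord_recl !big_ord0 !mxE /= ?c0 ?c0'; ring.
Qed.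

Definition mx3 (s : seq (seq R)) : 'M[R]_3 := \matrix_(p, q) (nth [::] s p)`_q.

(** Preserving the sums by index makes the new middle coordinate a + c and the sum of the new outer
    ones b; taking - c as the first coordinate preserves the form too. *)
Lemma word_signature_near i v : (i.+1 < N)%N ->
  word_signature ([:: (i, true); (i.+1, true); (i, true)] ++ v) =
  word_signature ([:: (i.+1, true); (i, true); (i.+1, true)] ++ v).
Proof.
move=> iN; rewrite !word_signature_cat.
have iN' := ltnW iN.
have c1 : adj_trunc i i.+1 = 2^-1.
  by rewrite /adj_trunc iN iN' /adj eqxx (ltn_eqF (_ : i < i.+2)%N) // subr0 mulr1.
have c2 : adj_trunc i.+1 i = - 2^-1 by rewrite adj_truncC c1.
have c0 k : adj_trunc k k = 0.
  by rewrite /adj_trunc /adj; case: ifP => // _; rewrite !ltn_eqF // subrr mulr0.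
(* [(a, b, c) |-> (- c, a + c, b + c)] and its inverse. *)
pose M := mx3 [:: [:: 0; 1; 0]; [:: 0; 0; 1]; [:: -1; 1; 1]].
pose M' := mx3 [:: [:: 1; 1; -1]; [:: 1; 0; 0]; [:: 0; 1; 0]].
apply: (@signature_join_iso _ _ _ _ _ _ _ _ _ _ _ _ _ M M');
  rewrite ?adj_mx_anti ?letter_form_sym //.
1,2: by apply/matrixP => p k; rewrite !mxE !big_ord_recl big_ord0 !mxE /=;
  case: p => [[|[|[|p]]] hp] //=; ring.
all: by move=> x; rewrite /qform !bil_sum !big_ord_recl !big_ord0 !mxE
  !big_ord_recl !big_ord0 !mxE /= ?c0 ?c1 ?c2; field.
Qed.

End Words.

(** * The Seifert form of a closed braid *)

Section ClosureSignature.
Variables (R : realFieldType) (N n : nat) (w : word) (hw : word_in n w).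
Hypothesis nN : (n <= N)%N.

Lemma cindexE (p : 'I_(size w)) : cindex p = (nth_letter w p).1.
Proof. by rewrite /cindex (tnth_nth (0, true)). Qed.

Lemma cindex_lt (p : 'I_(size w)) : ((cindex p).+1 < n)%N.
Proof. by apply: (allP hw); exact: mem_tnth. Qed.

Lemma mem_strand (p : 'I_(size w)) b j :
  ((p, b) \in strand w j) = (j == cindex p + b)%N.
Proof.
apply/mapP/eqP => [[q]|->].
  rewrite mem_filter => /andP[+ _] [-> ->].
  by case: eqP => [-> _|_ /= /eqP <-]; rewrite ?addn0 ?addn1.
exists p; last by case: b; rewrite ?addn0 ?addn1 // ?eqxx ?(ltn_eqF (ltnSn _)).
rewrite mem_filter mem_enum andbT.
by case: b; rewrite ?addn0 ?addn1 eqxx ?orbT.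
Qed.

Lemma strand_sorted j :
  sorted (fun a b : 'I_(size w) * bool => (a.1 < b.1)%N) (strand w j).
Proof.
rewrite sorted_map; apply: sorted_filter.
  by move=> x y z /=; exact: ltn_trans.
have := iota_ltn_sorted 0 (size w); rewrite -val_enum_ord sorted_map.
by apply: sub_sorted => x y.
Qed.

(** A closed strand runs through its crossings in the order of the letters of the word. *)
Lemma index_strand j (c d : 'I_(size w)) :
  (c, false) \in strand w j -> (d, true) \in strand w j ->
  (index (d, true) (strand w j) < index (c, false) (strand w j))%N = (d < c)%N.
Proof.
move=> hc hd.
have tr : transitive (fun a b : 'I_(size w) * bool => (a.1 < b.1)%N).
  by move=> x y z /=; exact: ltn_trans.
have lt := sorted_ltn_index tr (strand_sorted j).
apply/idP/idP => [|dc]; first exact: lt.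
rewrite ltnNge leq_eqVlt negb_or; apply/andP; split.
  by apply/eqP => /(index_inj (c, false) hc hd).
by apply/negP => /lt - /(_ hc hd) /=; rewrite ltnNge ltnW.
Qed.

(** Only strand [cindex c] has [c] on its right, so at most one Seifert circle contributes. *)
Lemma seifert_diskE (c d : 'I_(size w)) :
  seifert_disk R (Defs.closure hw) c d =
  if (cindex c == (cindex d).+1) then 2^-1 * (if (d < c)%N then 1 else -1)
  else 0.
Proof.
rewrite mxE /= big_map big_mkcond /=.
rewrite (bigD1_seq (cindex c)) ?iota_uniq //=; last first.
  by rewrite mem_iota /= add0n ltnW ?cindex_lt.
rewrite big1 ?addr0 => [|j /negPf jc]; last by rewrite mem_strand addn0 jc.
rewrite !mem_strand addn0 eqxx addn1 /=; case: eqP => // e.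
by rewrite index_strand // mem_strand ?addn0 ?addn1 ?e.
Qed.

Lemma seifert_form_closure : seifert_form R (Defs.closure hw) = word_form R N w.
Proof.
have cN (p : 'I_(size w)) : (cindex p < N)%N.
  by apply: leq_trans nN; rewrite ltnW ?cindex_lt.
apply/matrixP => c d; rewrite [LHS]mxE [X in X + _]mxE [X in _ + X]mxE.
rewrite (seifert_diskE c d) (seifert_diskE d c) !mxE -!cindexE.
rewrite /adj_trunc !cN /adj /=; case: eqVneq => [->|].
  by rewrite mulr1n (ltn_eqF (ltnSn _)) !addr0 /csign (tnth_nth (0, true)).
rewrite -val_eqE /= mulr0n add0r.
by case: ltngtP => // _ _; do 2!case: eqP => _; rewrite /=; ring.
Qed.

(** The boundary of [v] at strand j is the sum of [v] over index j - 1 (0 if j = 0) minus the sum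
    over index j. If it vanishes at every strand, all the sums vanish, by induction from strand
    0. *)
Lemma seifert_cycles_closure (v : 'rV[R]_(size w)) :
  (v <= seifert_cycles R (Defs.closure hw))%MS =
  (v <= kermx (word_cols R N w))%MS.
Proof.
pose T i := \sum_(p < size w) v 0 p * (cindex p == i)%:R.
have TC (i : 'I_N) : (v *m word_cols R N w) 0 i = T i.
  by rewrite mxE; apply: eq_bigr => p _; rewrite !mxE cindexE.
have szn : size (circles (Defs.closure hw)) = n by rewrite size_map size_iota.
have bdE (j : 'I_(size (circles (Defs.closure hw)))) :
    (v *m seifert_boundary R (Defs.closure hw)) 0 j =
    (if (j : nat) is i.+1 then T i else 0) - T j.
  have jn : (j < n)%N by rewrite -[X in (_ < X)%N]szn.
  have -> : (if (j : nat) is i.+1 then T i else 0) =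
      \sum_(p < size w) v 0 p * ((j : nat) == (cindex p).+1)%:R.
    case: (j : nat) => [|i]; first by rewrite big1 // => p _; rewrite mulr0.
    by apply: eq_bigr => p _; rewrite eqSS eq_sym.
  rewrite mxE /T -sumrB; apply: eq_bigr => p _; rewrite !mxE -mulrBr.
  rewrite (nth_map 0%N) ?size_iota // nth_iota //= add0n !mem_strand addn0 addn1.
  by rewrite [_ == cindex p]eq_sym.
apply/sub_kermxP/sub_kermxP => h.
  have T0 i : (i < n)%N -> T i = 0.
    elim: i => [|i ih] hi; move: (hi); rewrite -[X in (_ < X)%N]szn => hj;
      have := bdE (Ordinal hj); rewrite h mxE /=.
      by lra.
    by rewrite ih 1?ltnW //; lra.
  apply/rowP => i; rewrite TC mxE; case: (ltnP i n) => [/T0 //|ni].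
  (* No letter of [w] has index [n] or more. *)
  rewrite /T big1 // => p _; rewrite ltn_eqF ?mulr0 //.
  by apply: leq_trans ni; rewrite ltnW ?cindex_lt.
have T0 i : (i < n)%N -> T i = 0.
  by move=> hi; rewrite -(TC (Ordinal (leq_trans hi nN))) h mxE.
apply/rowP => j; rewrite bdE mxE.
have jn : (j < n)%N by rewrite -[X in (_ < X)%N]szn.
rewrite (T0 j) // subr0; case: (j : nat) jn => // i hi; exact/T0/ltnW.
Qed.

Lemma link_signature_closure :
  link_signature R (Defs.closure hw) = word_signature R N w.
Proof.
rewrite /link_signature seifert_form_closure.
apply: (@signature_iso _ _ _ _ _ _ _ 1%:M 1%:M); rewrite ?letter_form_sym // => v;
  by rewrite mulmx1 ?seifert_cycles_closure // -seifert_cycles_closure.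
Qed.

End ClosureSignature.

(** The context [y] makes the induction go through products. The bound [N0] depends on the
    derivation, whose intermediate words may involve generators of large index. *)
Lemma braid_eq_signature (R : realFieldType) u v : braid_eq u v ->
  exists N0, forall N, (N0 <= N)%N -> forall y,
    word_signature R N (u ++ y) = word_signature R N (v ++ y).
Proof.
elim=> {u v} [u|u v _ [N0 h]|u v w _ [N1 h1] _ [N2 h2]
  |u u' v v' _ [N1 h1] _ [N2 h2]|i b|i j ij|i].
- by exists 0.
- by exists N0 => N hN y; rewrite h.
- exists (maxn N1 N2) => N; rewrite geq_max => /andP[hN1 hN2] y.
  by rewrite h1 // h2.
- exists (maxn N1 N2) => N; rewrite geq_max => /andP[hN1 hN2] y.
  (* A rotation brings [v] to the front, where it can be replaced, and a second one undoes it. *)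
  rewrite -!catA h1 // word_signature_rot -catA h2 // [RHS]word_signature_rot.
  by rewrite -catA.
- by exists 0 => N _ y; rewrite word_signature_cancel.
- by exists 0 => N _ y; exact: word_signature_far.
- by exists i.+2 => N hN y; exact: word_signature_near.
Qed.

Lemma sigma_braid (R : realType) w : exists N0, forall N, (N0 <= N)%N ->
  sigma R (braid w) = (word_signature R N w)%:~R.
Proof.
have [|N1 h] := @braid_eq_signature R (repr (braid w)) w.
  by apply/braidP; rewrite reprbK.
(* [N] has to be large enough for the derivation and at least the width of the chosen word, whose
   Seifert form is then its word form. *)
exists (maxn N1 (width (repr (braid w)))) => N.
rewrite geq_max => /andP[hN1 hN2].
rewrite /sigma (link_signature_closure R (word_in_width _) hN2).
by have := h N hN1 [::]; rewrite !cats0 => ->.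
Qed.

(** * The quasimorphism inequality *)

Section Sigma.
Variable R : realType.

Lemma sigma_mulC a b : sigma R (a * b)%g = sigma R (b * a)%g.
Proof.
rewrite -(reprbK a) -(reprbK b) !braidM.
have [N1 h1] := sigma_braid R (repr a ++ repr b).
have [N2 h2] := sigma_braid R (repr b ++ repr a).
by rewrite (h1 _ (leq_maxl N1 N2)) (h2 _ (leq_maxr N1 N2)) word_signature_rot.
Qed.

Lemma sigma_mul_bound n k y : in_B n k ->
  `|sigma R (k * y)%g - sigma R k - sigma R y| <= n%:R.
Proof.
move=> [w hw ->]; rewrite -(reprbK y) braidM; set v := repr y.
have [N1 h1] := sigma_braid R (w ++ v).
have [N2 h2] := sigma_braid R w.
have [N3 h3] := sigma_braid R v.
pose N := maxn N1 (maxn N2 N3).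
rewrite (h1 N) ?(h2 N) ?(h3 N) ?leq_max ?leqnn ?orbT //.
rewrite -!rmorphB /= -intr_norm -[n%:R]/(n%:Z%:~R) ler_int word_signature_cat.
(* The [n] conditions are the vanishing of the sums over the indices below [n]; as [w] is a word in
   B_n, its sums over the other indices vanish anyway. *)
apply: (@signature_join_bound _ _ _ _ _ _ _ _ _ _
  (letter_cols R n (size w) (nth_letter w)));
  rewrite ?adj_mx_anti ?letter_form_sym // => x xG.
apply/rowP => i; rewrite mxE [RHS]mxE; case: (ltnP i n) => hi.
  move/rowP/(_ (Ordinal hi)): xG; rewrite mxE [RHS]mxE => xG; rewrite -[RHS]xG.
  by apply: eq_bigr => p _; rewrite !mxE.
rewrite big1 // => p _; rewrite mxE -cindexE ltn_eqF ?mulr0 //.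
by apply: leq_trans hi; rewrite ltnW ?(cindex_lt hw).
Qed.

(** The empty word lies in B_0, for which the defect bound is 0. *)
Lemma sigma1 : sigma R 1%g = 0.
Proof.
have /(sigma_mul_bound 1%g) : in_B 0 1%g by exists [::].
by rewrite mulg1 subrr sub0r normrN normr_le0 => /eqP.
Qed.

Lemma sigma_conj_product n (s : seq (Binf * Binf)) b :
  (forall x, x \in s -> in_B n x.2) ->
  `|sigma R ((\prod_(x <- s) (x.1 * x.2 * x.1^-1)) * b)%g
    - \sum_(x <- s) sigma R x.2 - sigma R b| <= n%:R * (size s)%:R.
Proof.
elim: s => [|[g k] s ih] hs.
  by rewrite !big_nil mul1g subr0 subrr normr0 mulr0.
rewrite !big_cons /=; set P := (\prod_(x <- s) _)%g in ih *.
have hk : in_B n k by apply: (hs (g, k)); rewrite mem_head.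
have {}ih := ih (fun x xs => hs x (mem_behead (xs : x \in behead ((g, k) :: s)))).
(* Moving [g] around cyclically leaves [k] in front of a conjugate of [P * b], so splitting off [k]
   costs [n]. *)
have -> : sigma R (g * k * g^-1 * P * b)%g =
    sigma R (k * (g^-1 * (P * b) * g))%g.
  by rewrite -!mulgA (sigma_mulC g) -!mulgA.
have e : sigma R (g^-1 * (P * b) * g)%g = sigma R (P * b)%g.
  by rewrite sigma_mulC mulgA mulgV mul1g.
have := sigma_mul_bound (g^-1 * (P * b) * g)%g hk; rewrite e => h.
rewrite -natr1 mulrDr mulr1; move: h ih; rewrite !ler_norml.
by move=> /andP[? ?] /andP[? ?]; apply/andP; split; lra.
Qed.

(** The sum of the signatures of the conjugated factors of [a] is within [n * l] both of
    [sigma R (a * b) - sigma R b] and, taking 1 for [b], of [sigma R a]. Hence the factor 2. *)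
Lemma sigma_nu_bound n (hn : (1 < n)%N) a b :
  `|sigma R (a * b)%g - sigma R a - sigma R b| <= 2 * n%:R * (nu hn a)%:R.
Proof.
rewrite /nu; case: ex_minnP => l /asboolP[s [<- sB ->]] _.
have := sigma_conj_product b sB; have := sigma_conj_product 1%g sB.
rewrite mulg1 sigma1 !ler_norml.
by move=> /andP[? ?] /andP[? ?]; apply/andP; split; lra.
Qed.

End Sigma.

Unset Implicit Arguments.

Theorem theorem2p5 (R : realType) (n : nat) (hn : (2 <= n)%N) :
  exists C : R, 0 < C /\
    forall a b : Binf,
      `|sigma R (a * b)%g - sigma R a - sigma R b|
        <= C * (minn (nu hn a) (nu hn b))%:R.
Proof.
exists (2 * n%:R); split; first by rewrite mulr_gt0 ?ltr0n // ltnW.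
move=> a b; rewrite /minn; case: ifP => _; first exact: sigma_nu_bound.
(* The bound by [nu hn b] is the one just used, for the product [b * a]. *)
by rewrite sigma_mulC addrAC; exact: sigma_nu_bound.
Qed.
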